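(* For every integer $k\geq 1$, $\left\vert\mathsf{APS}^+_{2k}\setminus \mathsf{APS}_{2k}\right\vert =2^{2k-1} - \binom{2k}{k}$.
   Context: For $n\in\mathbb{N}$, $[n]=\{1,\dots,n\}$ and $\pm[n]=[n]\cup -[n]$. $\mathfrak{S}_n$ is the symmetric group of bijections of $[n]$, and $\mathfrak{S}_n^B$ is the group of signed permutations, i.e. bijections $w:\pm[n]\to\pm[n]$ with $w(-i)=-w(i)$, written in one-line notation $w(1)\cdots w(n)$ (so $\mathfrak{S}_n\subseteq\mathfrak{S}_n^B$). A pinnacle of $w$ is a value $w(i)$ with $2\le i\le n-1$ and $w(i-1)<w(i)>w(i+1)$; the pinnacle set of $w$ is the set of its pinnacles. $\mathsf{APS}_n$ is the set of pinnacle sets of elements of $\mathfrak{S}_n$, $\mathsf{APS}^B_n$ is the set of pinnacle sets of elements of $\mathfrak{S}_n^B$, and $\mathsf{APS}^+_n=\{S\in\mathsf{APS}^B_n : S\subset\mathbb{N}\}$, where $\mathbb{N}=\{1,2,3,\dots\}$. *)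

(* Defs.v *)
From HB Require Import structures.
From mathcomp Require Import all_boot all_order all_algebra all_fingroup.
From mathcomp Require Import finmap.

Set Implicit Arguments.
Unset Strict Implicit.
Unset Printing Implicit Defensive.

Import Order.TTheory GRing.Theory Num.Theory.

Local Open Scope fset_scope.
Local Open Scope ring_scope.

(* [n] and +-[n] as finite sets of integers; a bijection of such a set [A]
   is an element of {perm A}, with [A] coerced to its finType of elements. *)
Definition seg (n : nat) : {fset int} := [fset (nat_of_ord i).+1%:Z | i in 'I_n].

Definition pmseg (n : nat) : {fset int} :=
  seg n `|` [fset - x | x in seg n].

Definition is_signed (n : nat) (w : {perm (pmseg n)}) : bool :=
  [forall i : pmseg n, forall j : pmseg n,
     (val j == - val i) ==> (val (w j) == - val (w i))].

(* Positions i, j, l are the consecutive indices j - 1, j, j + 1 of the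
   one-line notation w(1) ... w(n); the domain [A] is [n] or +-[n]. *)
Definition is_peak (n : nat) (A : {fset int}) (w : {perm A}) (j : A) : bool :=
  (2 <= val j <= n%:Z - 1) &&
  [exists i : A, exists l : A,
     [&& val i == val j - 1, val l == val j + 1,
         val (w i) < val (w j) & val (w l) < val (w j)]].

Definition pinnacle_set (n : nat) (A : {fset int}) (w : {perm A}) : {fset int} :=
  [fset val (w j) | j in [pred j : A | is_peak n w j]].

Definition APS (n : nat) : {fset {fset int}} :=
  [fset pinnacle_set n w | w in {perm (seg n)}].

Definition APSB (n : nat) : {fset {fset int}} :=
  [fset pinnacle_set n w | w in [pred w : {perm (pmseg n)} | is_signed w]].

Definition APSpos (n : nat) : {fset {fset int}} :=
  [fset S in APSB n | all (fun x : int => 0 < x) S].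

(* Main.v *)
(** For [n >= 1], a set [S] of [1..n] is a pinnacle set of a permutation iff
    every [x] in [S] satisfies [2 #{y in S | y <= x} < x] ("ballot" sets):
    each pinnacle has a smaller non-pinnacle on its left, and the last one
    also on its right; conversely, list [S] and its complement increasingly
    and alternate them, starting with the complement.  The same alternation
    with a negated complement produces, as a signed pinnacle set, every [S]
    with [2 #S < n], and no larger one occurs.  So one counts the non-ballot
    sets of size less than [k] in [1..2k]: by Pascal's rule on whether
    [n + 1] belongs to the set, those of size [m + 1] in [1..n + 1] number
    [2 'C(n, m)] as long as [2 (m + 1) <= n + 1]. *)

Require Import Defs.
From HB Require Import structures.
From mathcomp Require Import all_boot all_order all_algebra all_fingroup.
From mathcomp Require Import finmap zify.

Import Order.TTheory GRing.Theory Num.Theory.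

Local Open Scope fset_scope.
Local Open Scope ring_scope.

(** * Membership in [n] and +-[n] *)

Lemma in_seg n (x : int) : (x \in seg n) = (0 < x <= n%:Z).
Proof.
apply/imfsetP/idP => [[i _ ->]|xn]; first by have := ltn_ord i; lia.
have xn' : (`|x|.-1 < n)%N by lia.
by exists (Ordinal xn') => //=; lia.
Qed.

Lemma in_pmseg n (x : int) : (x \in pmseg n) = (0 < `|x| <= n)%N.
Proof.
rewrite /pmseg in_fsetU in_seg; apply/orP/idP => [[|/imfsetP[y]]|xn].
- by lia.
- by rewrite in_seg => ? ->; lia.
case: (ltP 0 x) => x0; [left; lia | right].
apply/imfsetP; exists (- x); last by rewrite opprK.
by rewrite in_seg; lia.
Qed.

(** * Pinnacles of a word *)

Fixpoint pins (s : seq int) : seq int :=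
  if s is a :: s' then
    if s' is b :: c :: _ then
      if (a < b) && (c < b) then b :: pins s' else pins s'
    else [::]
  else [::].

(** The only pinnacle that could be lost with [a] is [b], and [b] lies below [a]. *)
Lemma pins_descent a b s : b < a -> pins (a :: b :: s) = pins (b :: s).
Proof. by move=> ba; case: s => //= c s; rewrite (lt_gtF ba). Qed.

Lemma pins_cons3 a b c s : pins [:: a, b, c & s] =
  if (a < b) && (c < b) then b :: pins [:: b, c & s] else pins [:: b, c & s].
Proof. by []. Qed.

Lemma subseq_pins s : subseq (pins s) (behead s).
Proof.
elim: s => // a [|b [|c s]] // IH; rewrite pins_cons3; case: ifP => _.
  by rewrite /= eqxx.
exact: subseq_trans IH (subseq_cons _ _).
Qed.

Lemma uniq_pins s : uniq s -> uniq (pins s).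
Proof.
move=> su; apply: subseq_uniq (subseq_pins s) _.
by case: s su => //= a s /andP[].
Qed.

(** Matches the recursion of [pins] with the positions of [is_peak]. Indices start at 0, so index
    [i.+1] is position [i + 2]. *)
Lemma mem_pinsP s x :
  reflect (exists i, [/\ (i.+2 < size s)%N, x = s`_i.+1,
                         s`_i < x & s`_i.+2 < x])
          (x \in pins s).
Proof.
elim: s => [|a [|b [|c s]] IH]; try by right=> -[i []].
have tail : reflect (exists i, [/\ (i.+3 < size [:: a, b, c & s])%N,
    x = [:: a, b, c & s]`_i.+2, [:: a, b, c & s]`_i.+1 < x
    & [:: a, b, c & s]`_i.+3 < x]) (x \in pins [:: b, c & s]) by exact: IH.
rewrite pins_cons3; case: ifP => abc; first rewrite in_cons.
  apply: (iffP orP) => [[/eqP->|/tail[i iP]]|[[|i] iP]].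
  - by exists 0%N; case/andP: abc.
  - by exists i.+1.
  - by left; case: iP => _ ->.
  - by right; apply/tail; exists i.
apply: (iffP tail) => [[i iP]|[[|i] iP]]; first by exists i.+1.
  by case: iP => /= _ -> ab cb; rewrite ab cb in abc.
by exists i.
Qed.

(* Every counted pinnacle is preceded by a counted non-pinnacle, and the last
   one is also followed by one. *)
Lemma count_pins (P : pred int) s :
    (forall x y, x < y -> P y -> P x) -> has P (pins s) ->
  (2 * count P (pins s) < count P s)%N.
Proof.
move=> Pdown; rewrite has_count.
have [m] := ubnP (size s); elim: m s => // m IH [|a [|b [|c s]]] //.
rewrite ltnS => sm; rewrite pins_cons3.
case: ifP => [/andP[ab cb]|_]; last first.
  by move=> /(IH [:: b, c & s] sm) /leq_trans-> //=; rewrite leq_addl.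
(* The letters [a] and [b] are removed together. If [b] is counted, so are [a] and [c]: [a] pays for
   [b], and [c] makes the inequality strict when no later pinnacle is counted. *)
rewrite pins_descent //; have := IH (c :: s) (ltnW sm).
move: (pins (c :: s)) => p /=.
move: (Pdown _ _ ab) (Pdown _ _ cb).
by case: (P b) => [/(_ isT)-> /(_ isT)->|_ _]; lia.
Qed.

Lemma size_pins s : pins s != [::] -> (2 * size (pins s) < size s)%N.
Proof.
move=> s0; rewrite -!count_predT.
by apply: count_pins => //; rewrite has_predT; case: (pins s) s0.
Qed.

(** * Alternating non-pinnacles and pinnacles *)

Fixpoint weave (o s : seq int) : seq int :=
  match o, s with
  | x :: o', y :: s' => [:: x, y & weave o' s']
  | _, [::] => o
  | [::], _ => s
  end.

Lemma perm_weave o s : perm_eq (weave o s) (o ++ s).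
Proof.
elim: s o => [|y s IH] [|x o] //=; first by rewrite cats0.
rewrite perm_cons perm_sym -cat1s perm_catCA /= perm_cons perm_sym; exact: IH.
Qed.

Lemma pins_sorted o : sorted <%O o -> pins o = [::].
Proof.
elim: o => // a [|b [|c o]] //= IH /and3P[_ bc co].
by rewrite (lt_gtF bc) andbF IH //= bc.
Qed.

(** Each letter of [s] stands between two consecutive letters of [o]; it exceeds the right one by
    hypothesis, hence also the left one. A letter of [o] is never a peak: it is next to a larger
    letter of [s] or in the increasing tail. *)
Lemma pins_weave o s : sorted <%O o -> (size s < size o)%N ->
  (forall i, (i < size s)%N -> o`_i.+1 < s`_i) -> pins (weave o s) = s.
Proof.
elim: s o => [|y s IH] [|x o] //= so.
  by move=> _ _; apply: (pins_sorted (x :: o)).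
rewrite ltnS; case: o so => // x' o so sz os.
have x'y : x' < y by exact: (os 0%N).
have xy : x < y by case/andP: so => /lt_trans->.
have := IH (x' :: o) (path_sorted so) sz (fun i => os i.+1).
(* Exposes the letter after [y], so that [pins] computes on the first three letters. *)
have [r ->] : exists r, weave (x' :: o) s = x' :: r.
  by case: (s) => [|z u]; [exists o | exists (z :: weave o u)].
by rewrite xy x'y -/(pins [:: y, x' & r]) pins_descent // => ->.
Qed.

(** * From permutations to words *)

(** Peaks only involve positions in [n], so any domain containing [n] is treated at once. Position p
    is index p - 1 of [s]. *)
Lemma pinnacle_setE n (A : {fset int}) (w : {perm A}) (s : seq int) :
    {subset seg n <= A} -> size s = n ->
    (forall x : A, fsval x \in seg n -> fsval (w x) = s`_(`|fsval x|.-1)) ->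
  pinnacle_set n w =i pins s.
Proof.
move=> nA sn ws x; apply/imfsetP/mem_pinsP => [[j]|[i [isz -> s1 s2]]].
  move=> /= /andP[jn /existsP[i /existsP[l /and4P[/eqP ij /eqP lj]]]] /=.
  rewrite /= in jn ij lj.
  rewrite !ws ?in_seg; try lia.
  rewrite ij lj => + + ->; move: (fsval j) jn => z jn wi wl.
  exists (`|z|.-2)%N; split.
  - by rewrite sn; lia.
  - by congr (nth _ _ _); lia.
  - by have -> : (`|z|.-2 = `|(z - 1)%R|.-1)%N by lia.
  - by have -> : (`|z|.-2.+2 = `|(z + 1)%R|.-1)%N by lia.
have inA (m : nat) : (m < n)%N -> exists x : A, fsval x = m.+1%:Z.
  move=> mn; have mA : m.+1%:Z \in A by rewrite nA // in_seg; lia.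
  by exists [` mA].
rewrite sn in isz; have [x2 x2E] := inA _ isz.
have [x1 x1E] := inA _ (ltnW isz); have [x0 x0E] := inA _ (ltnW (ltnW isz)).
suff x1_peak : is_peak n w x1.
  by exists x1; [exact: x1_peak | rewrite /= ws x1E // in_seg; lia].
rewrite /is_peak /= x1E; apply/andP; split; first by lia.
apply/existsP; exists x0; apply/existsP; exists x2.
rewrite /= !ws ?x0E ?x1E ?x2E ?in_seg /= ?s1 ?s2 ?andbT; lia.
Qed.

(** A general [A] may miss a position, whence the default 0; [seg n] and [pmseg n] contain every
    position from 1 to [n]. *)
Definition word n {A : {fset int}} (w : {perm A}) : seq int :=
  mkseq (fun i => oapp (val \o w) 0 (insub i.+1%:Z)) n.

Lemma nth_word n (A : {fset int}) (w : {perm A}) (x : A) :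
  fsval x \in seg n -> (word n w)`_(`|fsval x|.-1) = fsval (w x).
Proof.
rewrite in_seg => xn; rewrite nth_mkseq; last by lia.
have -> : (`|fsval x|.-1.+1)%:Z = fsval x by lia.
by rewrite valK.
Qed.

Lemma absz_sgzM (x y : int) : x != 0 -> `|(sgz x * y)%R|%N = `|y|%N.
Proof.
move=> x0; have [->|->] : sgz x = 1 \/ sgz x = -1 by lia.
  by rewrite mul1r.
by rewrite mulN1r abszN.
Qed.

(* The odd extension of a word, which on positive arguments is the word itself:
   this one formula serves both [seg n] and [pmseg n]. *)
Lemma word_perm (A : {fset int}) (s : seq int) :
    (forall x, x \in A -> sgz x * s`_(`|x|.-1) \in A) ->
    {in A &, injective (fun x : int => sgz x * s`_(`|x|.-1))} ->
  {w : {perm A} | forall x, fsval (w x) = sgz (fsval x) * s`_(`|fsval x|.-1)}.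
Proof.
move=> sA s_inj; pose f (x : A) : A := [` sA _ (valP x)].
have f_inj : injective f.
  move=> x y /(congr1 val) /= fxy; apply: val_inj; apply: s_inj fxy; exact: valP.
by exists (perm f_inj) => x; rewrite permE.
Qed.

(** A permutation of [n] amounts to a word of [n] distinct letters of [n]: [word] gives one
    direction, [word_perm] the other. *)
Lemma APSP n (S : {fset int}) :
  reflect (exists s, [/\ size s = n, uniq s, {subset s <= seg n} & S =i pins s])
          (S \in APS n).
Proof.
apply: (iffP (imfsetP _ _ _ _)) => [[w _ ->]|[s [sn su sA Ss]]].
  have inA (i : nat) : (i < n)%N -> i.+1%:Z \in seg n by rewrite in_seg; lia.
  exists (word n w); split; first by rewrite size_mkseq.
  - apply/mkseq_uniqP => i j /inA iA /inA jA; rewrite !insubT /=.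
    by move=> /val_inj/perm_inj/(congr1 val) /=; lia.
  - by move=> x /mapP[i]; rewrite mem_iota => /inA iA ->; rewrite insubT; exact: valP.
  - by apply: pinnacle_setE; rewrite ?size_mkseq // => x /nth_word.
have [||w wE] := @word_perm (seg n) s.
- move=> x xn; have -> : sgz x = 1 by move: xn; rewrite in_seg; lia.
  by rewrite mul1r sA // mem_nth // sn; move: xn; rewrite in_seg; lia.
- move=> x y; rewrite !in_seg => xn yn.
  have -> : sgz x = 1 by lia.
  have -> : sgz y = 1 by lia.
  by rewrite !mul1r => /eqP; rewrite nth_uniq ?sn // => [/eqP||]; lia.
exists w => //; apply/fsetP => x; rewrite Ss; symmetry; apply: pinnacle_setE => //.
move=> y; rewrite wE in_seg => yn; have -> : sgz (fsval y) = 1 by lia.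
by rewrite mul1r.
Qed.

(** A signed permutation is determined by w(1) ... w(n), and oddness turns its injectivity into
    distinctness of the absolute values. *)
Lemma APSBP n (S : {fset int}) :
  reflect (exists s, [/\ size s = n, uniq [seq `|x|%N | x <- s],
                         {subset s <= pmseg n} & S =i pins s])
          (S \in APSB n).
Proof.
have segA : {subset seg n <= pmseg n}.
  by move=> x; rewrite in_seg in_pmseg; lia.
apply: (iffP (imfsetP _ _ _ _)) => [[w w_sg ->]|[s [sn su sA Ss]]].
  have inA (i : nat) : (i < n)%N -> i.+1%:Z \in pmseg n by rewrite in_pmseg; lia.
  have wN (x y : pmseg n) : fsval y = - fsval x -> fsval (w y) = - fsval (w x).
    move/eqP => yx; apply/eqP.
    by move: w_sg => /forallP/(_ x)/forallP/(_ y)/implyP; apply.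
  exists (word n w); split; first by rewrite size_mkseq.
  - rewrite -map_comp; apply/mkseq_uniqP => i j /inA iA /inA jA; rewrite /= !insubT /=.
    have jA' : - j.+1%:Z \in pmseg n by move: jA; rewrite !in_pmseg; lia.
    (* Equal absolute values mean that [w] takes the same value at [i + 1] and at [j + 1] or its
       opposite; injectivity leaves only [i = j]. *)
    move=> ij; have [] : fsval (w [` iA]) = fsval (w [` jA]) \/
                         fsval (w [` iA]) = fsval (w [` jA']).
    + rewrite (wN [` jA] [` jA']) //; move: ij.
      by move: (fsval (w [` iA])) (fsval (w [` jA])) => a b; lia.
    + by move=> /val_inj/perm_inj/(congr1 val) /=; lia.
    + by move=> /val_inj/perm_inj/(congr1 val) /=; lia.
  - by move=> x /mapP[i]; rewrite mem_iota => /inA iA ->; rewrite insubT; exact: valP.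
  - by apply: pinnacle_setE; rewrite ?size_mkseq // => x /nth_word.
have [||w wE] := @word_perm (pmseg n) s.
- move=> x; rewrite in_pmseg => xn.
  have : s`_(`|x|.-1) \in pmseg n by rewrite sA // mem_nth // sn; lia.
  by rewrite !in_pmseg absz_sgzM //; lia.
- move=> x y; rewrite !in_pmseg => xn yn xy.
  have xs : s`_(`|x|.-1) \in pmseg n by rewrite sA // mem_nth // sn; lia.
  have ys : s`_(`|y|.-1) \in pmseg n by rewrite sA // mem_nth // sn; lia.
  have xy' : `|x|.-1%N = `|y|.-1%N.
    apply/eqP; rewrite -(nth_uniq 0%N _ _ su) ?size_map ?sn; try lia.
    by rewrite !(nth_map 0) ?sn; lia.
  (* If [x = - y], the two equal images are also opposite, hence 0, which [pmseg n] excludes. *)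
  have : x = y \/ x = - y by lia.
  case=> // xNy; move: xy xs; rewrite xy' xNy in_pmseg sgzN mulNr.
  have [->|->] : sgz y = 1 \/ sgz y = -1 by lia.
    by rewrite mul1r; lia.
  by rewrite mulN1r; lia.
exists w.
  apply/forallP => x; apply/forallP => y; apply/implyP => /= /eqP yx.
  by rewrite /= !wE yx sgzN mulNr abszN.
apply/fsetP => x; rewrite Ss; symmetry; apply: pinnacle_setE => //.
move=> y; rewrite wE in_seg => yn; have -> : sgz (fsval y) = 1 by lia.
by rewrite mul1r.
Qed.

(** * Criteria for unsigned and for positive signed pinnacle sets *)

Lemma card_seg n : #|` seg n| = n.
Proof. by rewrite card_imfset ?size_enum_ord // => i j [] /val_inj. Qed.

Lemma count_le_seg n (x : int) : x \in seg n -> count (<= x) (seg n) = `|x|%N.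
Proof.
rewrite in_seg => xn; rewrite -[RHS]card_seg -size_filter; apply: perm_size.
apply: uniq_perm; rewrite ?filter_uniq ?fset_uniq // => y.
by rewrite mem_filter !in_seg /=; lia.
Qed.

Definition ballot (S : {fset int}) : bool :=
  all (fun x => (2 * count (<= x)%R S < `|x|)%N) S.

Lemma card_pins n s (S : {fset int}) :
    (0 < n)%N -> size s = n -> uniq s -> S =i pins s -> (2 * #|` S| < n)%N.
Proof.
move=> n0 sn su Ss; rewrite -sn in n0 *; have pu := uniq_pins _ su.
have -> : #|` S| = size (pins s) by apply: perm_size; exact: uniq_perm.
by have [->|/size_pins] := eqVneq (pins s) [::].
Qed.

Lemma perm_fsetD_sort (A S : {fset int}) : S `<=` A ->
  perm_eq ((A `\` S) ++ sort <=%O S) A.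
Proof.
move=> SA; apply: uniq_perm => //.
  rewrite cat_uniq sort_uniq !fset_uniq andbT /=; apply/hasPn => x.
  by rewrite mem_sort inE => ->.
move=> x; rewrite mem_cat mem_sort in_fsetD.
by case: (boolP (x \in S)) => [/(fsubsetP SA)->|_]; rewrite ?orbT ?orbF.
Qed.

Lemma mem_APS n (S : {fset int}) : (0 < n)%N ->
  (S \in APS n) = (S `<=` seg n) && ballot S.
Proof.
move=> n0; apply/APSP/andP => [[s [sn su sA Ss]]|[SA Sb]].
  have pu := uniq_pins _ su.
  have SA : {subset S <= seg n}.
    move=> x; rewrite Ss => /(mem_subseq (subseq_pins s)) /mem_behead; exact: sA.
  split; first exact/fsubsetP.
  apply/allP => x xS; rewrite -(count_le_seg n) ?SA //.
  have -> : count (<= x) S = count (<= x) (pins s).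
    by have /seq.permP-> : perm_eq S (pins s) by apply: uniq_perm.
  (* The letters at most [x] form a down-closed class containing the pinnacle [x]; being distinct
     elements of [n], they are no more numerous there than in [n]. *)
  apply: leq_trans (count_pins _ _ _ _) _.
  - by move=> y z yz; apply: le_trans (ltW yz).
  - by apply/hasP; exists x; [rewrite -Ss | exact: lexx].
  rewrite -!size_filter; apply: uniq_leq_size; first exact: filter_uniq.
  by move=> y; rewrite !mem_filter => /andP[-> /sA].
pose o : seq int := sort <=%O (seg n `\` S); pose r : seq int := sort <=%O S.
have o_r : perm_eq (o ++ r) (seg n).
  apply: perm_trans (perm_fsetD_sort _ _ SA).
  by rewrite perm_cat2r perm_sort.
have w_n : perm_eq (weave o r) (seg n) := perm_trans (perm_weave o r) o_r.
have so : sorted <%O o by rewrite sort_lt_sorted fset_uniq.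
have sr : sorted <%O r by rewrite sort_lt_sorted fset_uniq.
(* Up to the pinnacle of index [i] there are [i + 1] members, so the ballot condition puts more than
   [i + 1] non-members below it; hence the non-member of index [i + 1] is smaller. *)
have cnt i : (i < size r)%N -> (i.+1 < count (< r`_i)%R o)%N.
  move=> ir; set x := r`_i; have xr : x \in r by exact: mem_nth.
  have xS : x \in S by rewrite mem_sort in xr.
  have xn : x \in seg n by exact: (fsubsetP SA).
  have := allP Sb _ xS; have /seq.permP/(_ (<= x)) := o_r.
  rewrite count_cat count_le_seg // (count_le_nth _ sr ir) => <-.
  have /seq.permP<- : perm_eq r S by rewrite perm_sort.
  rewrite (count_le_nth _ sr ir).
  have -> : count (<= x) o = count (< x) o.
    apply: eq_in_count => y; rewrite mem_sort in_fsetD /= => /andP[yS _].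
    by rewrite le_eqVlt; case: eqP => // yx; rewrite yx xS in yS.
  by lia.
(* If there is a last pinnacle, [cnt] at it suffices; otherwise [o] has all [n > 0] letters. *)
have sz : (size r < size o)%N.
  case E : (size r) => [|m]; last first.
    by rewrite -E; apply: leq_trans (count_size _ _); rewrite E; apply: cnt; rewrite E.
  by have := perm_size o_r; rewrite size_cat E addn0 card_seg => ->.
exists (weave o r); split.
- by rewrite (perm_size w_n) card_seg.
- by rewrite (perm_uniq w_n) fset_uniq.
- by move=> x; rewrite (perm_mem w_n).
rewrite pins_weave // => [x|i ir]; first by rewrite mem_sort.
by apply: nth_count_lt; [exact: sort_le_sorted | exact: cnt].
Qed.

(** Once the non-pinnacles are negated, every element of [S] exceeds all of them, so only the number
    of letters matters. *)
Lemma mem_APSpos n (S : {fset int}) : (0 < n)%N ->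
  (S \in APSpos n) = (S `<=` seg n) && (2 * #|` S| < n)%N.
Proof.
move=> n0; rewrite /APSpos !inE /=; apply/andP/andP.
  case=> /APSBP[s [sn su sA Ss]] /allP S0; split; last first.
    by apply: card_pins sn _ Ss => //; apply: map_uniq su.
  apply/fsubsetP => x xS; have /= x0 := S0 _ xS.
  have : x \in pmseg n.
    by apply: sA; apply: mem_behead; apply: (mem_subseq (subseq_pins s)); rewrite -Ss.
  by rewrite in_pmseg in_seg; lia.
case=> SA Sn; split; last first.
  by apply/allP => x /(fsubsetP SA); rewrite in_seg => /andP[].
apply/APSBP.
pose o : seq int := sort <=%O [seq - x | x <- seg n `\` S].
pose r : seq int := sort <=%O S.
have absz_inj : {in seg n &, injective absz}.
  by move=> x y; rewrite !in_seg; lia.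
(* Up to signs the woven word rearranges [n]; this yields its length and the distinctness of its
   absolute values. *)
have w_n : perm_eq [seq `|x|%N | x <- weave o r] [seq `|x|%N | x <- seg n].
  apply: perm_trans (perm_map absz (perm_weave o r)) _.
  apply: perm_trans (perm_map absz (perm_fsetD_sort _ _ SA)).
  rewrite !map_cat perm_cat2r.
  have -> : [seq `|x|%N | x <- seg n `\` S]
            = [seq `|x|%N | x <- [seq - x | x <- seg n `\` S]].
    by rewrite -map_comp; apply: eq_map => x /=; rewrite abszN.
  by apply: perm_map; rewrite perm_sort.
have o_lt0 x : x \in o -> x < 0.
  by rewrite mem_sort => /mapP[y]; rewrite in_fsetD in_seg => yn ->; lia.
have r_gt0 x : x \in r -> 0 < x.
  by rewrite mem_sort => /(fsubsetP SA); rewrite in_seg => /andP[].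
have size_r : size r = #|` S| by rewrite size_sort.
have sz : (size r < size o)%N.
  rewrite size_r size_sort size_map.
  have := perm_size (perm_fsetD_sort _ _ SA); rewrite size_cat size_sort card_seg.
  by move: (#|` S|) (#|` seg n `\` S|) Sn => a b Sn; rewrite addnC; lia.
exists (weave o r); split.
- by have := perm_size w_n; rewrite !size_map card_seg.
- by rewrite (perm_uniq w_n) map_inj_in_uniq ?fset_uniq.
- move=> x /(map_f absz); rewrite (perm_mem w_n) => /mapP[y].
  by rewrite in_seg in_pmseg; lia.
rewrite pins_weave // => [x||i ir]; first by rewrite mem_sort.
  by rewrite sort_lt_sorted map_inj_uniq ?fset_uniq //; exact: oppr_inj.
apply: lt_trans (r_gt0 _ (mem_nth 0 ir)).
by apply: o_lt0; apply: mem_nth; apply: leq_trans sz.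
Qed.

(** * Counting non-ballot sets by size *)

(** The subsets of [n], listed according to their largest possible element so that [count] obeys a
    recursion in [n]. *)
Fixpoint psets n : seq {fset int} :=
  if n is m.+1 then psets m ++ [seq m.+1%:Z |` T | T <- psets m]
  else [:: fset0].

Lemma seg_recr n : seg n.+1 = n.+1%:Z |` seg n.
Proof. by apply/fsetP => x; rewrite in_fset1U !in_seg; lia. Qed.

Lemma notin_sub_seg n (S : {fset int}) : S `<=` seg n -> n.+1%:Z \notin S.
Proof.
by move=> /fsubsetP SA; apply/negP => /SA; rewrite in_seg; lia.
Qed.

Lemma mem_psets n (S : {fset int}) : (S \in psets n) = (S `<=` seg n).
Proof.
elim: n S => [|n IH] S /=.
  rewrite inE -fsubset0; congr (_ `<=` _).
  by apply/fsetP => x; rewrite in_seg in_fset0; lia.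
rewrite mem_cat IH seg_recr; apply/orP/idP => [[SA|/mapP[T]]|SA].
- exact: fsubset_trans SA (fsubsetU1 _ _).
- by rewrite IH => TA ->; apply: fsetUS.
have [nS|nS] := boolP (n.+1%:Z \in S); [right | left].
  apply/mapP; exists (S `\ n.+1%:Z); last by rewrite fsetD1K.
  by rewrite IH fsubDset.
apply/fsubsetP => x xS; have := fsubsetP SA _ xS.
by rewrite in_fset1U => /orP[/eqP xE|//]; rewrite -xE xS in nS.
Qed.

Lemma uniq_psets n : uniq (psets n).
Proof.
elim: n => //= n IH; rewrite cat_uniq IH /=; apply/andP; split.
  apply/hasPn => _ /mapP[S _ ->] /=; rewrite mem_psets.
  by apply/negP => /notin_sub_seg; rewrite fset1U1.
rewrite map_inj_in_uniq // => S T; rewrite !mem_psets.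
by move=> /notin_sub_seg nS /notin_sub_seg nT ST; rewrite -(fsetU1K nS) ST fsetU1K.
Qed.

Lemma count_psetsS (P : pred {fset int}) n :
  count P (psets n.+1) =
  (count P (psets n) + count (fun S => P (n.+1%:Z |` S)%fset) (psets n))%N.
Proof. by rewrite /= count_cat count_map. Qed.

Lemma ballot0 : ballot fset0.
Proof. by apply/allP => x; rewrite in_fset0. Qed.

(** As [n + 1] exceeds all of [S], the conditions at the elements of [S] are unchanged, while its
    own condition involves the whole set. *)
Lemma ballotU1 n (S : {fset int}) : S `<=` seg n ->
  ballot (n.+1%:Z |` S) = (2 * #|` S|.+1 < n.+1)%N && ballot S.
Proof.
move=> SA; have nS := notin_sub_seg _ _ SA.
have pS : perm_eq (n.+1%:Z |` S) (n.+1%:Z :: S).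
  apply: uniq_perm; rewrite /= ?nS ?fset_uniq // => x.
  by rewrite in_fset1U in_cons.
rewrite /ballot (perm_all _ pS) /=; congr andb.
  have /seq.permP-> := pS; rewrite /= lexx add1n.
  suff -> : count (<= n.+1%:Z) S = #|` S| by [].
  apply/eqP; rewrite -all_count; apply/allP => x /(fsubsetP SA).
  by rewrite in_seg /=; lia.
apply: eq_in_all => x xS; have /seq.permP-> := pS.
have := fsubsetP SA _ xS; rewrite in_seg /= => xn.
by have -> : (n.+1%:Z <= x) = false by lia.
Qed.

(** A ballot set is a pinnacle set, so the bound on the number of pinnacles applies. *)
Lemma ballot_card n (S : {fset int}) : (0 < n)%N -> S `<=` seg n -> ballot S ->
  (2 * #|` S| < n)%N.
Proof.
move=> n0 SA Sb; have /APSP[s [sn su _ Ss]] : S \in APS n by rewrite mem_APS // SA.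
exact: card_pins sn su Ss.
Qed.

Lemma count_psets_card n m : count (fun S => #|` S| == m) (psets n) = 'C(n, m).
Proof.
elim: n m => [|n IH] m.
  by rewrite -[LHS]/((#|` fset0 : {fset int}| == m) + 0)%N cardfs0; case: m.
rewrite count_psetsS IH.
have cardU S : S \in psets n -> #|` (n.+1%:Z |` S)%fset| = #|` S|.+1.
  by rewrite mem_psets => /notin_sub_seg nS; rewrite cardfsU1 nS.
case: m => [|m].
  rewrite bin0 (eq_in_count (a2 := pred0)) ?count_pred0 ?bin0 // => S /cardU.
  by move=> /= ->.
rewrite binS -(IH m); congr (_ + _)%N.
by apply: eq_in_count => S /cardU /= ->.
Qed.

Definition nonballot n m : nat :=
  count (fun S => (#|` S| == m) && ~~ ballot S) (psets n).

Lemma nonballot0 n : nonballot n 0 = 0%N.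
Proof.
rewrite /nonballot (eq_count (a2 := pred0)) ?count_pred0 // => S /=.
by rewrite cardfs_eq0; case: eqP => // ->; rewrite ballot0.
Qed.

Lemma bin_central m : 'C(m.*2.+1, m.+1) = 'C(m.*2.+1, m).
Proof. by rewrite -[RHS]bin_sub; [congr binomial | ]; lia. Qed.

Lemma nonballotE n m : (m.+1.*2 <= n.+1)%N ->
  nonballot n.+1 m.+1 = (2 * 'C(n, m))%N.
Proof.
elim: n m => [|n IH] m; first by lia.
(* When [2 (m + 1) = n + 1], no set of size [m + 1] is ballot. *)
rewrite leq_eqVlt => /orP[/eqP mn|mn].
  have -> : nonballot n.+2 m.+1 = 'C(n.+2, m.+1).
    rewrite -count_psets_card /nonballot.
    apply: (@eq_in_count {fset int}) => S; rewrite mem_psets => SA.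
    case: eqP => //= Sm; apply/negP => /(ballot_card _ _ (ltn0Sn _) SA).
    by rewrite Sm; lia.
  have -> : n = m.*2 by lia.
  by rewrite binS bin_central mul2n addnn.
rewrite /nonballot count_psetsS -/(nonballot n.+1 m.+1).
(* As [2 (m + 1) < n + 2], the ballot condition at [n + 2] holds, so a failure comes from the rest,
   a set of size [m]. *)
have -> : count (fun S => (#|` (n.+2%:Z |` S)%fset| == m.+1)
                          && ~~ ballot (n.+2%:Z |` S)%fset) (psets n.+1)
          = nonballot n.+1 m.
  rewrite /nonballot; apply: (@eq_in_count {fset int}) => S; rewrite mem_psets => SA.
  rewrite cardfsU1 (notin_sub_seg _ _ SA) add1n eqSS ballotU1 //.
  by case: eqP => //= ->; have -> : (2 * m.+1 < n.+2)%N by lia.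
rewrite IH; last by lia.
(* Pascal's rule adds the two counts; for [m = 0] the second one vanishes, the empty set being
   ballot. *)
case: m mn => [|m] mn; first by rewrite nonballot0 !bin0.
by rewrite IH ?binS ?mulnDr //; lia.
Qed.

(** * Summation over the sizes *)

Lemma count_small_nonballot n k :
  count (fun S => (#|` S| < k)%N && ~~ ballot S) (psets n)
  = (\sum_(m < k) nonballot n m)%N.
Proof.
elim: k => [|k IH]; first by rewrite big_ord0 (eq_count (a2 := pred0)) ?count_pred0.
rewrite big_ord_recr /= -IH /nonballot -count_predUI.
rewrite [X in (_ + X)%N](eq_count (a2 := pred0)) => [|S /=]; last first.
  by case: ltngtP; rewrite ?andbF.
rewrite count_pred0 addn0; apply: eq_count => S /=.
by rewrite ltnS; case: ltngtP; rewrite ?orbF.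
Qed.

(** Row [2K + 1] of Pascal's triangle is symmetric with [2K + 2] entries, so its first half sums to
    half of [2 ^ (2K + 1)]. *)
Lemma sum_bin_half K : (\sum_(j < K.+1) 'C(K.*2.+1, j) = 2 ^ K.*2)%N.
Proof.
have tot : (\sum_(j < K.*2.+2) 'C(K.*2.+1, j) = 2 ^ K.*2.+1)%N.
  by rewrite -[2%N]/(1 + 1)%N expnDn; apply: eq_bigr => i _; rewrite !exp1n !muln1.
move: tot; have -> : K.*2.+2 = (K.+1 + K.+1)%N by lia.
rewrite big_split_ord /= expnS.
have -> : (\sum_(i < K.+1) 'C(K.*2.+1, K.+1 + i)
          = \sum_(i < K.+1) 'C(K.*2.+1, i))%N.
  rewrite (reindex_inj rev_ord_inj) /=; apply: eq_bigr => i _.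
  have iK := ltn_ord i; rewrite -bin_sub; last by lia.
  by congr binomial; lia.
by rewrite addnn mul2n => /double_inj.
Qed.

Theorem theorem4p12 (k : nat) (hk : (1 <= k)%N) :
  (#|` APSpos (2 * k) `\` APS (2 * k)|)%:Z
  = 2 ^+ (2 * k - 1) - ('C(2 * k, k))%:Z.
Proof.
have n0 : (0 < 2 * k)%N by lia.
have -> : #|` APSpos (2 * k) `\` APS (2 * k)|
          = count (fun S => (#|` S| < k)%N && ~~ ballot S) (psets (2 * k)).
  rewrite -size_filter; apply: perm_size; apply: uniq_perm.
  - exact: fset_uniq.
  - exact: filter_uniq (uniq_psets _).
  move=> S; rewrite in_fsetD mem_APS // mem_APSpos // mem_filter mem_psets.
  by rewrite ltn_mul2l /=; case: (S `<=` _); rewrite ?andbT ?andbF //= andbC.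
rewrite count_small_nonballot; case: k hk n0 => // K _ _.
(* Here [k = K + 1]. Size 0 contributes nothing, and size [i + 1] contributes [2 'C(2K + 1, i)]. *)
rewrite big_ord_recl nonballot0 add0n.
have -> : (2 * K.+1 = K.*2.+2)%N by lia.
have -> : (\sum_(i < K) nonballot K.*2.+2 (lift ord0 i)
           = \sum_(i < K) 2 * 'C(K.*2.+1, i))%N.
  by apply: eq_bigr => i _; rewrite lift0 nonballotE //; have := ltn_ord i; lia.
(* The central coefficient is [2 'C(2K + 1, K)], twice the one term of the half row that the sum
   over [i < K] leaves out. *)
rewrite -big_distrr /= binS bin_central.
have := sum_bin_half K; rewrite big_ord_recr /= => E.
have -> : (K.*2.+2 - 1 = K.*2.+1)%N by lia.
by rewrite exprS -natrX -E; lia.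
Qed.
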